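(* Let $h>0$ and $\xi\in\mathbb R$. The coefficients $f_{\xi;\ell}$, $\ell=0,\dots,r$, of the SIAC spline kernel of degree $k$ and reproduction degree $r$ with index sequence $\mathcal J=(j_0,\dots,j_r)$ and knot sequence $h\mathbf t+\xi=(ht_0+\xi,\dots,ht_n+\xi)$ are polynomials of degree $r$ in $\xi$: $$[f_{\xi;\ell}]_{\ell=0,\dots,r}=M_{0,\mathbf t,\mathcal J}^{-1}\;\operatorname{diag}\Big(\big[(-1)^\ell\tbinom{\ell+k+1}{\ell}\big]_{\ell=0,\dots,r}\Big)\;\operatorname{diag}(1,h^{-1},\dots,h^{-r})\;(1,\xi,\dots,\xi^r)^{\mathsf T}.$$ Here $f_{\xi;\ell}$ is the coefficient of $B(\cdot\,|\,ht_{j_\ell:j_\ell+k+1}+\xi)$.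
   Context: Notation: $t_{i:j}=(t_i,\dots,t_j)$. For a non-decreasing sequence $t_{i:j}$ and sufficiently smooth $g$, divided differences are $\Delta(t_i)g=g(t_i)$ and, for $j>i$, $\Delta(t_{i:j})g=(\Delta(t_{i+1:j})g-\Delta(t_{i:j-1})g)/(t_j-t_i)$ if $t_i\ne t_j$, and $=g^{(j-i)}(t_i)/(j-i)!$ if $t_i=t_j$. B-spline: for knots $t_i\le\dots\le t_{i+k+1}$ with $t_i<t_{i+k+1}$, $B(x\,|\,t_{i:i+k+1}):=(k+1)\,\Delta(t_{i:i+k+1})\big(\max\{\cdot-x,0\}\big)^k$, the B-spline of degree $k$ with unit integral (values at knots are immaterial). SIAC spline kernel: let $\mathcal J=(j_0,\dots,j_r)$ be strictly increasing integers with $j_0=0$, let $n=j_r+k+1$, and let $\mathbf t=t_{0:n}$ be non-decreasing real knots with $t_j<t_{j+k+1}$ for $j\in\mathcal J$. The SIAC spline kernel of degree $k$ and reproduction degree $r$ with index sequence $\mathcal J$ and knots $t_{0:n}$ is the spline $f=\sum_{\ell=0}^r f_{\ell}\,B(\cdot\,|\,t_{j_\ell:j_\ell+k+1})$ whose coefficients are such that $\big(f*(-\cdot)^\delta\big)(x)=(-x)^\delta$ for all $x\in\mathbb R$, $\delta=0,\dots,r$, where $(f*g)(x)=\int_{\mathbb R} f(t)g(x-t)\,\mathrm dt$. Reproduction matrix: $M_{0,\mathbf t,\mathcal J}:=\big[\Delta(t_{j:j+k+1})\,x^{k+1+\delta}\big]_{\delta=0,\dots,r,\ j\in\mathcal J}$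 (divided difference of the monomial $x\mapsto x^{k+1+\delta}$), an invertible $(r+1)\times(r+1)$ matrix. *)

(* Defs.v *)
From HB Require Import structures.
From mathcomp Require Import all_boot all_order all_algebra.
From mathcomp Require Import all_classical all_reals all_analysis.

Set Implicit Arguments.
Unset Strict Implicit.
Unset Printing Implicit Defensive.

Import Order.TTheory GRing.Theory Num.Theory.
Import numFieldNormedType.Exports.

Local Open Scope ring_scope.

(* [divdiff t g i m] is the divided difference of [g] at the [m.+1] knots
   t_i, ..., t_(i+m); it is meant for [t] non-decreasing on these indices. *)
Fixpoint divdiff (R : realType) (t : nat -> R) (g : R -> R) (i m : nat) : R :=
  match m with
  | 0 => g (t i)
  | m'.+1 =>
      if t i == t (i + m'.+1)%N then derive1n m'.+1 g (t i) / (m'.+1)`!%:R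
      else (divdiff t g i.+1 m' - divdiff t g i m') / (t (i + m'.+1)%N - t i)
  end.

(* (max{u, 0})^k, with the convention that it vanishes for u <= 0 also when
   k = 0; [Num.max u 0 ^+ 0] would be the constant 1. *)
Definition truncpow (R : realType) (k : nat) (u : R) : R :=
  if 0 < u then u ^+ k else 0.

(* The B-spline of degree k with knots t_i, ..., t_(i+k+1). When [x] is one of
   these knots, [divdiff] may differentiate [truncpow] where it is not smooth;
   this concerns finitely many [x] only and does not affect integrals. *)
Definition bspline (R : realType) (k : nat) (t : nat -> R) (i : nat) (x : R)
    : R :=
  k.+1%:R * divdiff t (fun y => truncpow k (y - x)) i k.+1.

Definition convolution (R : realType) (f g : R -> R) (x : R) : R :=
  (\int[@lebesgue_measure R]_(s in setT) (f s * g (x - s)))%R.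

Definition spline (R : realType) (r k : nat) (j : 'I_r.+1 -> nat)
    (t : nat -> R) (c : 'cV[R]_r.+1) (x : R) : R :=
  \sum_(l < r.+1) c l 0 * bspline k t (j l) x.

(* [c] is a vector of coefficients of the SIAC spline kernel of degree k and
   reproduction degree r with index sequence [j] and knots [t]. *)
Definition siac_coefs (R : realType) (r k : nat) (j : 'I_r.+1 -> nat)
    (t : nat -> R) (c : 'cV[R]_r.+1) : Prop :=
  forall d : nat, (d <= r)%N -> forall x : R,
    convolution (spline k j t c) (fun y => (- y) ^+ d) x = (- x) ^+ d.

Definition reproduction_mx (R : realType) (r k : nat) (j : 'I_r.+1 -> nat)
    (t : nat -> R) : 'M[R]_r.+1 :=
  \matrix_(d < r.+1, l < r.+1)
    divdiff t (fun x => x ^+ (k.+1 + d)) (j l) k.+1.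

Definition siac_formula (R : realType) (r k : nat) (j : 'I_r.+1 -> nat)
    (t : nat -> R) (h xi : R) : 'cV[R]_r.+1 :=
  invmx (reproduction_mx k j t)
  *m diag_mx (\row_(l < r.+1) ((-1) ^+ l * 'C(l + k.+1, l)%:R))
  *m diag_mx (\row_(l < r.+1) h ^- l)
  *m \col_(l < r.+1) xi ^+ l.

(* Main.v *)
Require Import Defs.
From HB Require Import structures.
From mathcomp Require Import all_boot all_order all_algebra.
From mathcomp Require Import all_classical all_reals all_analysis.
From mathcomp Require Import ring zify.

Set Implicit Arguments.
Unset Strict Implicit.
Unset Printing Implicit Defensive.

Import Order.TTheory GRing.Theory Num.Theory.
Import numFieldNormedType.Exports.

Local Open Scope ring_scope.

(** The coefficient vector [c] is characterized by one linear system, and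
    everything else is read off from it.

    Moments.  A B-spline is a divided difference of truncated powers, so
    integrating it against a polynomial gives the Peano representation
      int B_i(s) P^`(k.+1)(s) ds = (k+1)! * divided difference of P
    ([bspline_peano]).  With P a multiple of (X - x)^(k+1+d) this yields the
    moments of order d about x.  By the binomial theorem, reproduction of
    degree d at every x is equivalent to reproduction at the single point
    x = xi; there the affine change of knots t -> h t + xi turns the divided
    difference of (X - xi)^(k+1+d) into h^d times the entry of the reproduction
    matrix M.  Hence [c] is a vector of kernel coefficients iff M c has the
    entries (-1)^d binom(d+k+1, d) h^(-d) xi^d
    ([siac_coefs_linear_system]).

    Invertibility.  All minors of M that matter are positive
    ([det_pdivdiff_gt0]).  Row 0 of M consists of ones, so subtracting from
    each column its predecessor and expanding along row 0 leaves the
    differences of consecutive columns.  Sliding the knot window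
    one step at a time writes such a difference as a nonnegative combination of
    divided differences over windows with one more knot, paired with one power
    less.  Multilinearity then gives a nonnegative combination of determinants
    of the same shape and smaller size, at least one of which has positive
    weight, so that induction on the size applies.

    Degree.  The coefficient of xi^r in the l-th kernel coefficient is a
    nonzero multiple of the (l, r) entry of M^-1, that is, of the minor of M
    without its last row and its column l.  That minor is again a
    determinant of the same shape, for the index sequence without j_l, hence
    nonzero. *)

(** * Divided differences of polynomials *)

Definition nondecr_upto (R : realType) (t : nat -> R) (N : nat) : Prop :=
  forall a b, (a <= b)%N -> (b <= N)%N -> t a <= t b.

(** The polynomial comes last so that [pdivdiff t i m] can be declared a linear
    form. *)
Definition pdivdiff (R : realType) (t : nat -> R) (i m : nat) (p : {poly R})
    : R :=
  divdiff t (horner p) i m.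

Section PolynomialDividedDifferences.
Variable R : realType.
Implicit Types (t : nat -> R) (p q : {poly R}) (i m n d N : nat).

Lemma divdiffS t (g : R -> R) i m : divdiff t g i m.+1 =
  if t i == t (i + m.+1)%N then derive1n m.+1 g (t i) / (m.+1)`!%:R
  else (divdiff t g i.+1 m - divdiff t g i m) / (t (i + m.+1)%N - t i).
Proof. by []. Qed.

Lemma derive1n_horner p n : derive1n n (horner p) = horner p^`(n).
Proof. by elim: n => [//|n IHn]; rewrite derive1nS IHn derivnS derivE. Qed.

Lemma pdivdiff0 t p i : pdivdiff t i 0 p = p.[t i].
Proof. by []. Qed.

Lemma pdivdiffS t p i m :
  pdivdiff t i m.+1 p =
  if t i == t (i + m.+1)%N then p^`N(m.+1).[t i]
  else (pdivdiff t i.+1 m p - pdivdiff t i m p) / (t (i + m.+1)%N - t i).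
Proof.
rewrite /pdivdiff divdiffS; case: ifP => // _.
rewrite derive1n_horner (nderivn_def m.+1 p) hornerMn.
by rewrite -[X in X / _]mulr_natr mulfK.
Qed.

Lemma pdivdiff_coincident t p i m :
  t i = t (i + m)%N -> pdivdiff t i m p = p^`N(m).[t i].
Proof.
by case: m => [|m] tt; rewrite ?pdivdiff0 ?nderivn0 // pdivdiffS -tt eqxx.
Qed.

Lemma pdivdiff_is_linear t i m : linear_for *%R (pdivdiff t i m).
Proof.
move=> a p q.
elim: m i => [|m IHm] i; first by rewrite !pdivdiff0 !hornerE.
rewrite !pdivdiffS; case: ifP => _.
  by rewrite nderivnD nderivnZ !hornerE.
by rewrite !IHm; ring.
Qed.

HB.instance Definition _ t i m :=
  GRing.isLinear.Build R {poly R} R *%R (pdivdiff t i m)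
    (@pdivdiff_is_linear t i m).

Lemma nderivn_mulXsubC_root p a n :
  ((('X - a%:P) * p)^`N(n.+1)).[a] = p^`N(n).[a].
Proof.
have -> : ('X - a%:P) * p = (p * 'X + 0%:P) - a *: p.
  by rewrite -mul_polyC polyC0; ring.
by rewrite nderivnB nderivnZ nderivnMXaddC !hornerE; ring.
Qed.

Lemma nondecr_coincident t N i m a : nondecr_upto t N -> (i + m <= N)%N ->
  t i = t (i + m)%N -> (i <= a <= i + m)%N -> t a = t i.
Proof.
move=> t_nd iN tt /andP[ia am]; apply/le_anti.
by rewrite {1}tt !t_nd //; exact: leq_trans am iN.
Qed.

(** The Leibniz rule for a linear factor that vanishes at an end knot: the knot
    is simply dropped.  The two versions feed each other in the induction, since
    the two windows that the recursion compares have different end knots. *)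
Lemma pdivdiff_mulXsubC t N p i m : nondecr_upto t N -> (i + m.+1 <= N)%N ->
  pdivdiff t i m.+1 (('X - (t i)%:P) * p) = pdivdiff t i.+1 m p /\
  pdivdiff t i m.+1 (('X - (t (i + m.+1)%N)%:P) * p) = pdivdiff t i m p.
Proof.
move=> t_nd; elim: m i => [|m IHm] i iN.
  have t1 : t (i + 1)%N = t i.+1 by rewrite addn1.
  rewrite !pdivdiffS !pdivdiff0 t1; case: eqVneq => [<-|tt].
    by rewrite nderivn_mulXsubC_root nderivn0.
  have ? : t i.+1 - t i != 0 by rewrite subr_eq0 eq_sym.
  by rewrite !hornerE; split; field.
have [tt|tt] := eqVneq (t i) (t (i + m.+2)%N).
  have co := nondecr_coincident t_nd iN tt.
  rewrite -tt pdivdiff_coincident // nderivn_mulXsubC_root.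
  by rewrite !pdivdiff_coincident ?co //; lia.
have tiS : t (i.+1 + m.+1)%N = t (i + m.+2)%N by rewrite addSnnS.
have [|Ll _] := IHm i; first lia.
have [|_] := IHm i.+1; first lia.
rewrite tiS => Lr.
have nz : t (i + m.+2)%N - t i != 0 by rewrite subr_eq0 eq_sym.
(* Trading one root for the other costs a multiple of p. *)
have swap j n : pdivdiff t j n (('X - (t (i + m.+2)%N)%:P) * p) =
    pdivdiff t j n (('X - (t i)%:P) * p)
    - (t (i + m.+2)%N - t i) * pdivdiff t j n p.
  rewrite -linearZ -linearB /=; congr (pdivdiff _ _ _ _).
  by rewrite -mul_polyC polyCB; ring.
have left : pdivdiff t i m.+2 (('X - (t i)%:P) * p) = pdivdiff t i.+1 m.+1 p.
  rewrite pdivdiffS (negbTE tt) Ll.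
  by move/eqP: (swap i.+1 m.+1); rewrite Lr eq_sym subr_eq => /eqP ->; field.
split=> //; rewrite swap left (pdivdiffS t p i m.+1) (negbTE tt).
by field.
Qed.

Lemma pdivdiff_mulX t N p i m : nondecr_upto t N -> (i + m.+1 <= N)%N ->
  pdivdiff t i m.+1 (p * 'X) = t i * pdivdiff t i m.+1 p + pdivdiff t i.+1 m p.
Proof.
move=> t_nd iN; have [<- _] := pdivdiff_mulXsubC p t_nd iN.
rewrite -linearZ -linearD /=; congr (pdivdiff _ _ _ _).
by rewrite -mul_polyC; ring.
Qed.

Lemma pdivdiff_Xn_small t N i m n : nondecr_upto t N -> (i + m <= N)%N ->
  (n < m)%N -> pdivdiff t i m 'X^n = 0.
Proof.
move=> t_nd; elim: n i m => [|n IHn] i [|m] //= iN nm.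
  have C1 j l : (0 < l)%N -> pdivdiff t j l 'X^0 = 0.
    elim: l j => // l IHl j _; rewrite pdivdiffS expr0 (nderivnC 1).
    case: ifP => _; first by rewrite hornerC.
    case: l IHl => [|l] IHl; first by rewrite !pdivdiff0 !hornerE subrr mul0r.
    by rewrite -(expr0 'X) !IHl // subrr mul0r.
  exact: C1.
rewrite exprSr (pdivdiff_mulX _ t_nd iN) !IHn ?mulr0 ?addr0 //; lia.
Qed.

Lemma pdivdiff_size t N i m p : nondecr_upto t N -> (i + m <= N)%N ->
  (size p <= m)%N -> pdivdiff t i m p = 0.
Proof.
move=> t_nd iN pm; rewrite -[p]coefK poly_def linear_sum big1 //= => n _.
rewrite linearZ /= (pdivdiff_Xn_small t_nd iN) ?mulr0 //.
exact: leq_trans (ltn_ord n) pm.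
Qed.

Lemma pdivdiff_Xn t N i m : nondecr_upto t N -> (i + m <= N)%N ->
  pdivdiff t i m 'X^m = 1.
Proof.
move=> t_nd; elim: m i => [|m IHm] i iN; first by rewrite pdivdiff0 !hornerE.
rewrite exprSr (pdivdiff_mulX _ t_nd iN) IHm; last lia.
by rewrite (pdivdiff_Xn_small t_nd iN) // mulr0 add0r.
Qed.

(** The recursion read without division; it also holds for coincident knots,
    where both sides vanish. *)
Lemma pdivdiff_window_shift t N i m p : nondecr_upto t N -> (i + m.+1 <= N)%N ->
  pdivdiff t i.+1 m p - pdivdiff t i m p =
  (t (i + m.+1)%N - t i) * pdivdiff t i m.+1 p.
Proof.
move=> t_nd iN; have [tt|tt] := eqVneq (t i) (t (i + m.+1)%N); last first.
  by rewrite pdivdiffS (negbTE tt) mulrC mulfVK // subr_eq0 eq_sym.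
have co := nondecr_coincident t_nd iN tt.
by rewrite !pdivdiff_coincident ?co -?tt ?subrr ?mul0r //; lia.
Qed.

(** Each of the [m] divisions by a difference of knots, or each of the [m]
    differentiations, contributes one factor [a]. *)
Lemma pdivdiff_affine t i m p (a b : R) : a != 0 ->
  a ^+ m * pdivdiff (fun n => a * t n + b) i m p =
  pdivdiff t i m (p \Po (a *: 'X + b%:P)).
Proof.
move=> a0.
have dn n q : (q \Po (a *: 'X + b%:P))^`(n) =
    a ^+ n *: (q^`(n) \Po (a *: 'X + b%:P)).
  elim: n q => [|n IHn] q; first by rewrite scale1r.
  rewrite derivSn deriv_comp derivD derivZ derivX derivC addr0.
  rewrite alg_polyC mulrC mul_polyC linearZ /= IHn -derivSn.
  by rewrite scalerA -exprS.
have ndn n q : (q \Po (a *: 'X + b%:P))^`N(n) =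
    a ^+ n *: (q^`N(n) \Po (a *: 'X + b%:P)).
  apply: (@mulIf _ (n`!%:R)).
    by rewrite -polyC_natr polyC_eq0 pnatr_eq0 -lt0n fact_gt0.
  rewrite -scalerAl !mulr_natr -nderivn_def dn (nderivn_def n q).
  by rewrite (raddfMn (comp_poly (a *: 'X + b%:P))).
have ab x : (a *: 'X + b%:P).[x] = a * x + b by rewrite !hornerE.
elim: m i => [|m IHm] i; first by rewrite mul1r !pdivdiff0 horner_comp ab.
rewrite !pdivdiffS /=.
rewrite (inj_eq (addIr b)) (inj_eq (mulfI a0)); case: eqVneq => [tt|tt].
  by rewrite ndn hornerZ horner_comp ab.
have ? : t (i + m.+1)%N - t i != 0 by rewrite subr_eq0 eq_sym.
rewrite -!IHm exprS; field; apply/andP; split=> //.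
by rewrite opprD addrACA subrr addr0 -mulrBr mulf_neq0.
Qed.

End PolynomialDividedDifferences.

(** * Positivity of determinants of divided differences *)

(** Multilinearity in all columns at once: a choice [f] of one summand per column
    for every term. *)
Lemma det_sum_cols (F : comPzRingType) (n : nat) (I : finType)
    (w : 'I_n -> I -> F) (v : 'I_n -> I -> F) :
  \det (\matrix_(a < n, b < n) \sum_i w b i * v a i) =
  \sum_(f : {ffun 'I_n -> I})
    (\prod_b w b (f b)) * \det (\matrix_(a < n, b < n) v a (f b)).
Proof.
rewrite -[LHS]det_tr /determinant.
under eq_bigr => s _.
  under eq_bigr do rewrite !mxE.
  rewrite bigA_distr_bigA big_distrr /=.
  under eq_bigr do rewrite big_split /= mulrCA.
  over.
rewrite exchange_big /=; apply: eq_bigr => f _; rewrite -big_distrr /=.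
congr (_ * _); rewrite -[RHS]det_tr /determinant.
by apply: eq_bigr => s _; congr (_ * _); apply: eq_bigr => b _; rewrite !mxE.
Qed.

(** Subtracting from each column its predecessor turns a first row of ones into
    (1, 0, ..., 0), along which one expands. *)
Lemma det_consecutive_cols (F : comPzRingType) (n : nat) (g : nat -> nat -> F) :
  (forall b, g 0 b = 1) ->
  \det (\matrix_(a < n.+1, b < n.+1) g a b) =
  \det (\matrix_(a < n, b < n) (g a.+1 b.+1 - g a.+1 b)).
Proof.
move=> g0.
pose U : 'M[F]_n.+1 :=
  \matrix_(a, b) ((a == b :> nat)%:R - (a.+1 == b :> nat)%:R).
have detU : \det U = 1.
  rewrite -det_tr det_trig.
    rewrite big1 // => a _; rewrite !mxE eqxx.
    by rewrite eqn_leq ltnn subr0.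
  apply/is_trig_mxP => a b ab; rewrite !mxE.
  by rewrite !gtn_eqF ?subrr //; lia.
pose D : 'M[F]_n.+1 := \matrix_(a, b)
  (g a b - if nat_of_ord b is b'.+1 then g a b' else 0).
have pick (h : nat -> F) (c : nat) : (c < n.+1)%N ->
    \sum_(e < n.+1) h e * (e == c :> nat)%:R = h c.
  move=> cn; rewrite (bigD1 (Ordinal cn)) //= eqxx mulr1 big1 ?addr0 // => e.
  by rewrite -val_eqE /= => /negbTE ->; rewrite mulr0.
have DE : (\matrix_(a < n.+1, b < n.+1) g a b) *m U = D.
  apply/matrixP => a b; rewrite !mxE.
  under eq_bigr do rewrite !mxE mulrBr.
  rewrite sumrB (pick (g a)) //; congr (_ - _).
  case: b => -[|b] bn /=; first by rewrite big1 // => e _; rewrite mulr0.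
  by rewrite -[RHS]pick //; exact: ltnW.
rewrite -[LHS]mulr1 -detU -det_mulmx DE (expand_det_row _ 0) big_ord_recl big1.
  rewrite addr0 /cofactor addn0 expr0 mul1r !mxE /= g0 subr0 mul1r.
  by congr (\det _); apply/matrixP => a b; rewrite !mxE.
by move=> b _; rewrite !mxE /= !g0 subrr mul0r.
Qed.

(** Induction on the number [n] of windows.  The difference of columns [b] and
    [b.+1] is a sum over the windows that start at [i] with j b <= i < j b.+1; these
    ranges are disjoint and ordered, so every choice of one window per range is
    again strictly increasing.  The weights t (i + m.+1) - t i are nonnegative, and
    a product of positive weights is just the support condition for the longer
    windows. *)
Lemma det_pdivdiff_gt0 (R : realType) (t : nat -> R) (N n m : nat)
    (j : nat -> nat) :
  nondecr_upto t N ->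
  (forall a b, (a < b < n)%N -> (j a < j b)%N) ->
  (forall a, (a < n)%N -> (j a + m <= N)%N /\ t (j a) < t (j a + m)%N) ->
  0 < \det (\matrix_(a < n, b < n) pdivdiff t (j b) m 'X^(m + a)).
Proof.
move=> t_nd; elim: n m j => [|n IHn] m j j_incr j_supp.
  by rewrite det_mx00.
pose I := 'I_N.+1.
pose w (b : 'I_n) (i : I) : R :=
  if (j b <= i < j b.+1)%N then t (i + m.+1)%N - t i else 0.
have w_ge0 b i : 0 <= w b i.
  rewrite /w; case: ifP => // /andP[_ ij].
  rewrite subr_ge0 t_nd ?leq_addr //.
  by have [|] := j_supp b.+1; [exact: ltn_ord | lia].
have w_gt0 (f : {ffun 'I_n -> I}) : (forall b, 0 < w b (f b)) ->
    0 < \det (\matrix_(a < n, b < n) pdivdiff t (f b) m.+1 'X^(m.+1 + a)).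
  move=> wf.
  have fj (b : 'I_n) : (j b <= f b < j b.+1)%N /\ t (f b) < t (f b + m.+1)%N.
    by move: (wf b); rewrite /w; case: ifP => //; rewrite ?ltxx // subr_gt0.
  (* The induction hypothesis wants starting indices defined on all of nat. *)
  pose g b := if (insub b : option 'I_n) is Some b' then nat_of_ord (f b')
    else 0.
  have gE (b : 'I_n) : g b = f b by rewrite /g valK.
  suff : 0 < \det (\matrix_(a < n, b < n) pdivdiff t (g b) m.+1 'X^(m.+1 + a)).
    by congr (0 < \det _); apply/matrixP => a b; rewrite !mxE gE.
  apply: IHn => [a b /andP[ab bn]|a an].
    pose a' := Ordinal (ltn_trans ab bn); pose b' := Ordinal bn.
    rewrite (gE a') (gE b'); have [/andP[_ fa] _] := fj a'.
    have [/andP[fb _] _] := fj b'.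
    suff jj : (j a.+1 <= j b)%N by exact: leq_trans fa (leq_trans jj fb).
    have [->//|ne] := eqVneq a.+1 b.
    by apply/ltnW/j_incr; rewrite ltn_neqAle ne ab ltnW.
  rewrite (gE (Ordinal an)); have [/andP[_ fj'] ?] := fj (Ordinal an).
  split=> //; have [|] := j_supp a.+1; first by [].
  by move: fj' => /=; lia.
have -> : \det (\matrix_(a < n.+1, b < n.+1) pdivdiff t (j b) m 'X^(m + a)) =
    \sum_(f : {ffun 'I_n -> I}) (\prod_b w b (f b)) *
      \det (\matrix_(a < n, b < n) pdivdiff t (f b) m.+1 'X^(m.+1 + a)).
  (* The constant 1 out of range makes row 0 constant for all indices. *)
  pose M a b := if (b < n.+1)%N then pdivdiff t (j b) m 'X^(m + a) else 1.
  transitivity (\det (\matrix_(a < n.+1, b < n.+1) M a b)).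
    by congr (\det _); apply/matrixP => a b; rewrite !mxE /M ltn_ord.
  rewrite det_consecutive_cols; last first.
    move=> b; rewrite /M; case: ifP => // bn; rewrite addn0.
    by rewrite (pdivdiff_Xn t_nd) //; have [] := j_supp b.
  rewrite -(det_sum_cols w
    (fun a i => pdivdiff t i m.+1 'X^(m.+1 + a))).
  congr (\det _); apply/matrixP => a b; rewrite !mxE /M.
  rewrite !ltnS ltn_ord (ltnW (ltn_ord b)) -(addSnnS m a).
  have jj : (j b <= j b.+1)%N by apply/ltnW/j_incr; rewrite ltnSn ltnS ltn_ord.
  rewrite -(telescope_sumr (fun i => pdivdiff t i m _)) //.
  have [|jN _] := j_supp b.+1; first exact: ltn_ord.
  have jN' : (j b.+1 <= N.+1)%N by lia.
  rewrite (big_nat_widen _ _ _ _ _ jN')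
    (big_nat_widenl _ _ _ _ _ (leq0n (j b))).
  rewrite big_mkord big_mkcond /=; apply: eq_bigr => i _.
  rewrite /w andbC; case: ifP => [/andP[ji ij]|_]; last by rewrite mul0r.
  rewrite (pdivdiff_window_shift _ t_nd) //.
  by apply: leq_trans jN; rewrite addnS -addSn leq_add2r.
have prod_ge0 (f : {ffun 'I_n -> I}) : 0 <= \prod_b w b (f b).
  exact: prodr_ge0.
(* Keeping the first window of each range gives a positive term, because a
   window with distinct end knots keeps them distinct when it is prolonged. *)
pose f0 : {ffun 'I_n -> I} := [ffun b => inord (j (nat_of_ord b))].
have f0E (b : 'I_n) : f0 b = j b :> nat.
  have [|jN _] := j_supp b; first exact/ltnW/ltn_ord.
  by rewrite ffunE inordK //; lia.
have f0_gt0 (b : 'I_n) : 0 < w b (f0 b).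
  have [|jN] := j_supp b; first exact/ltnW/ltn_ord.
  have [|jN' _] := j_supp b.+1; first exact: ltn_ord.
  have jj : (j b < j b.+1)%N by apply: j_incr; rewrite ltnSn ltnS ltn_ord.
  rewrite /w f0E leqnn jj subr_gt0 => /lt_le_trans -> //.
  by apply: t_nd; lia.
rewrite (bigD1 f0) //= ltr_wpDr //.
  apply: sumr_ge0 => f _; have [/eqP f00|] := eqVneq (\prod_b w b (f b)) 0.
    by rewrite (eqP f00) mul0r.
  rewrite prodf_seq_neq0 => /allP wf; rewrite mulr_ge0 // ltW //.
  apply: w_gt0 => b; rewrite lt_neqAle w_ge0 eq_sym andbT.
  by apply: wf; rewrite mem_index_enum.
by rewrite mulr_gt0 ?w_gt0 // prodr_gt0.
Qed.

(** * Integrals on the real line *)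

Section IntegralCertificates.
Variable R : realType.
Implicit Types (f g : R -> R) (u v a : R).
Local Notation mu := (@lebesgue_measure R).

(** Integrability and value together, so that linear combinations need no
    separate integrability argument. *)
Definition has_integral f v : Prop :=
  mu.-integrable setT (EFin \o f) /\ (\int[mu]_x (f x)%:E = v%:E)%E.

Lemma has_integral_Rintegral f v : has_integral f v ->
  (\int[mu]_(x in setT) f x)%R = v.
Proof. by case=> _; rewrite /Rintegral => ->. Qed.

Lemma has_integral_indic1 a : has_integral \1_[set a] 0.
Proof.
split; last by rewrite integral_indic // setIT; exact: lebesgue_measure_set1.
have := integrable_indic_itv a a true false.
by rewrite /= set_itv1.
Qed.

Lemma has_integralP f g u v a : has_integral f u -> has_integral g v ->
  has_integral (fun x => a * f x + g x) (a * u + v).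
Proof.
move=> [fi fu] [gi gv].
have afi : mu.-integrable setT (fun x => a%:E * (f x)%:E)%E.
  exact: integrableZl.
split; first by have := integrableD measurableT afi gi.
under eq_integral do rewrite EFinD EFinM.
by rewrite (integralD measurableT afi gi) integralZl // fu gv.
Qed.

Lemma has_integral0 : has_integral (fun=> 0) 0.
Proof. by split; [exact: integrable0 | rewrite integral0]. Qed.

Lemma has_integralZ f u a : has_integral f u ->
  has_integral (fun x => a * f x) (a * u).
Proof.
move=> fu; have := has_integralP a fu has_integral0; rewrite addr0.
by congr has_integral; apply/funext => x; rewrite addr0.
Qed.

Lemma has_integral_sum (I : Type) (s : seq I) (f : I -> R -> R) (v : I -> R) :
  (forall i, has_integral (f i) (v i)) ->
  has_integral (fun x => \sum_(i <- s) f i x) (\sum_(i <- s) v i).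
Proof.
move=> fv; elim: s => [|i s IHs].
  by rewrite big_nil; under eq_fun do rewrite big_nil; exact: has_integral0.
rewrite big_cons; under eq_fun do rewrite big_cons.
have := has_integralP 1 (fv i) IHs; rewrite mul1r.
by congr has_integral; apply/funext => x; rewrite mul1r.
Qed.

(** Changing one value adds a multiple of the indicator of a point; this keeps
    measurability within reach without completing the measure. *)
Lemma has_integral_eq_off_point f g v a : (forall x, x != a -> f x = g x) ->
  has_integral g v -> has_integral f v.
Proof.
move=> fg gv; have := has_integralP (f a - g a) (has_integral_indic1 a) gv.
rewrite mulr0 add0r; congr has_integral; apply/funext => x.
have -> : \1_[set a] x = (x == a)%:R :> R.
  by rewrite indicE; congr (nat_of_bool _)%:R; apply/idP/eqP; rewrite inE.
by have [->|xa] := eqVneq x a; rewrite ?mulr1 ?subrK // mulr0 add0r fg.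
Qed.

Lemma has_integral_deriv_horner (p : {poly R}) a b : a <= b ->
  has_integral (fun x => ((a <= x) && (x <= b))%:R * p^`().[x]) (p.[b] - p.[a]).
Proof.
move=> ab.
have patchE : (fun x => (((a <= x) && (x <= b))%:R * p^`().[x])%:E) =
    ((EFin \o horner p^`()) \_ `[a, b]%classic).
  apply/funext => x; rewrite patchE mem_setE in_itv /=.
  by case: ifP; rewrite ?mul1r ?mul0r.
have ci : {within `[a, b], continuous (horner p^`())}%classic.
  by apply: continuous_subspaceT; exact: continuous_horner.
split.
  rewrite /comp patchE.
  have ii := continuous_compact_integrable (@segment_compact R a b) ci.
  have mkcond : mu.-integrable `[a, b]%classic (EFin \o horner p^`()) <->
      mu.-integrable setT ((EFin \o horner p^`()) \_ `[a, b]%classic).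
    by apply: integrable_mkcond; exact: measurable_itv.
  exact/(proj1 mkcond).
rewrite patchE -integral_mkcond.
move: ab; rewrite le_eqVlt => /predU1P[<-|ab].
  by rewrite set_itv1 integral_set1 subrr.
rewrite (@continuous_FTC2 _ _ (horner p)) //.
- split.
  + by move=> x _; exact: derivable_horner.
  + by apply: cvg_at_right_filter; exact: continuous_horner.
  + by apply: cvg_at_left_filter; exact: continuous_horner.
- by move=> x _; rewrite -derivE.
Qed.

End IntegralCertificates.

(** * The Peano representation of B-splines *)

Section Peano.
Variable R : realType.
Implicit Types (t : nat -> R) (P Q : {poly R}) (i m n d k N : nat) (A x y : R).

Lemma derivn_XsubC_exp n m x :
  (('X - x%:P) ^+ n)^`(m) = ('X - x%:P) ^+ (n - m) *+ n ^_ m.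
Proof.
elim: m => [|m IHm]; first by rewrite subn0 ffactn0.
rewrite derivnS IHm derivMn deriv_exp derivXsubC mul1r -mulrnA.
by rewrite ffactnSr subnS mulnC.
Qed.

Lemma near_eq_derive1n (f g : R -> R) n y :
  (\forall z \near y, f z = g z) ->
  \forall z \near y, derive1n n f z = derive1n n g z.
Proof.
move=> fg; elim: n => [//|n /nbhs_interior].
apply: filterS => z fgz; rewrite !derive1nS !derive1E.
exact: near_eq_derive.
Qed.

Lemma divdiff_near_eq t (f g : R -> R) i m :
  (forall a, (i <= a <= i + m)%N -> \forall z \near t a, f z = g z) ->
  divdiff t f i m = divdiff t g i m.
Proof.
elim: m i => [|m IHm] i fg /=.
  by apply: (nbhs_singleton (fg i _)); rewrite leqnn leq_addr.
rewrite (IHm i) ?(IHm i.+1); first last.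
- by move=> a ?; apply: fg; lia.
- by move=> a ?; apply: fg; lia.
have := nbhs_singleton (near_eq_derive1n m.+1 (fg i _)).
by rewrite /= => -> //; rewrite leqnn leq_addr.
Qed.

Lemma truncpow_near k x y : y != x ->
  \forall z \near y, truncpow k (z - x) =
    (if x < y then ('X - x%:P) ^+ k else 0).[z].
Proof.
move=> yx; case: ltP => xy.
  near=> z; rewrite /truncpow subr_gt0 ifT; last by near: z; exact: lt_nbhsr.
  by rewrite horner_exp !hornerE.
have {xy yx} xy : y < x by rewrite lt_neqAle yx.
near=> z; rewrite /truncpow subr_gt0 ifF ?horner0 //.
by apply/negbTE; rewrite -leNgt ltW //; near: z; exact: lt_nbhsl.
Unshelve. all: by end_near. Qed.

(** The exclusion of [x = t i] is what makes the derivatives in the divided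
    difference honest: away from [x] the truncated power is locally a polynomial. *)
Lemma divdiff_truncpow_coincident t i m k x :
  t i = t (i + m)%N -> (m <= k)%N -> x != t i ->
  divdiff t (fun y => truncpow k (y - x)) i m =
  'C(k, m)%:R * truncpow (k - m) (t i - x).
Proof.
case: m => [|m] tt mk xt; first by rewrite bin0 mul1r subn0.
rewrite divdiffS -tt eqxx.
have -> := nbhs_singleton (near_eq_derive1n m.+1 (truncpow_near k _)).
  rewrite -[RHS](@mulfK _ (m.+1)`!%:R) ?pnatr_eq0 -?lt0n ?fact_gt0 //.
  congr (_ / _); rewrite derive1n_horner /truncpow subr_gt0.
  case: ifP => _; last by rewrite linear0 horner0 mulr0 mul0r.
  rewrite derivn_XsubC_exp hornerMn horner_exp !hornerE /=.
  by rewrite -[LHS]mulr_natr -bin_ffact natrM; ring.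
by rewrite eq_sym.
Qed.

(** To the left of all knots the truncated power agrees near the knots with a
    polynomial of degree [k], which k + 2 knots annihilate. *)
Lemma bspline_left_eq0 t N k i x : nondecr_upto t N -> (i + k.+1 <= N)%N ->
  x < t i -> bspline k t i x = 0.
Proof.
move=> t_nd iN xt; rewrite /bspline.
rewrite (@divdiff_near_eq _ _ (horner (('X - x%:P) ^+ k))); last first.
  move=> a ai; have xa : x < t a by apply: lt_le_trans xt (t_nd _ _ _ _); lia.
  by have := truncpow_near k (negbT (gt_eqF xa)); rewrite xa.
rewrite -/(pdivdiff t i k.+1 (('X - x%:P) ^+ k)) (pdivdiff_size t_nd) ?mulr0 //.
by rewrite size_exp_XsubC.
Qed.

(** Repeated integration by parts of (y - X)^n Q^`(n.+1), written as an explicit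
    primitive; the hypothesis at [A] removes all boundary terms there. *)
Lemma vanishing_primitive n Q A y : (forall e, (e <= n)%N -> Q^`(e).[A] = 0) ->
  exists F : {poly R}, [/\ F^`() = (y%:P - 'X) ^+ n * Q^`(n.+1),
    F.[y] = n`!%:R * Q.[y] & F.[A] = 0].
Proof.
elim: n => [|n IHn] QA.
  by exists Q; rewrite expr0 !mul1r (QA 0).
have [|F [dF Fy FA]] := IHn; first by move=> e en; apply: QA; exact: leqW.
exists ((y%:P - 'X) ^+ n.+1 * Q^`(n.+1) + n.+1%:R *: F); split.
- rewrite derivD derivZ derivM -derivnS deriv_exp derivB derivC derivX dF /=.
  by rewrite -mul_polyC polyC_natr sub0r -mulr_natr; ring.
- rewrite hornerD hornerM horner_exp !hornerE subrr expr0n mul0r add0r Fy.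
  by rewrite factS natrM mulrA.
- by rewrite hornerD hornerM QA // hornerZ FA !mulr0 addr0.
Qed.

Lemma has_integral_truncpow n Q A y : A <= y ->
  (forall e, (e <= n)%N -> Q^`(e).[A] = 0) ->
  has_integral (fun x => (A <= x)%R%:R * truncpow n (y - x) * Q^`(n.+1).[x])
    (n`!%:R * Q.[y]).
Proof.
move=> Ay QA; have [F [dF Fy FA]] := vanishing_primitive y QA.
have := has_integral_deriv_horner F Ay; rewrite Fy FA subr0.
apply: (@has_integral_eq_off_point _ _ _ _ y) => x xy.
rewrite dF /truncpow subr_gt0 lt_neqAle xy /=.
case: (A <= x); rewrite ?mul0r //; case: (x <= y); rewrite ?mulr0 ?mul0r //.
by rewrite !mul1r hornerM horner_exp !hornerE.
Qed.

(** Divided differences in [y] commute with the integral over [x].  A single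
    truncated power is not integrable on the line, hence the cut-off at [A]; the
    vanishing of [P] at [A] makes the result a divided difference of [P] itself,
    without a Taylor polynomial.  Each window of coincident knots excludes just one
    value of [x]. *)
Lemma has_integral_divdiff_truncpow t N k P A i m :
  nondecr_upto t N -> (i + m <= N)%N -> A <= t i ->
  (m <= k)%N \/ (m = k.+1 /\ t i < t (i + m)%N) ->
  (forall e, (e <= k)%N -> P^`(e).[A] = 0) ->
  has_integral (fun x => (A <= x)%R%:R *
      divdiff t (fun y => truncpow k (y - x)) i m * P^`(k.+1).[x])
    (k`!%:R * pdivdiff t i m P).
Proof.
move=> t_nd + + + PA.
have coincident n a : t a = t (a + n)%N -> (n <= k)%N -> A <= t a ->
    has_integral (fun x => (A <= x)%R%:R *
      divdiff t (fun y => truncpow k (y - x)) a n * P^`(k.+1).[x])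
    (k`!%:R * pdivdiff t a n P).
  move=> tt nk Aa; rewrite pdivdiff_coincident //.
  have QA e : (e <= k - n)%N -> (P^`(n)^`(e)).[A] = 0.
    by move=> ek; rewrite /derivn -iterD -/(derivn _ _) PA //; lia.
  have := has_integralZ 'C(k, n)%:R (has_integral_truncpow Aa QA).
  have -> : P^`(n)^`((k - n).+1) = P^`(k.+1).
    by rewrite /derivn -iterD addSn subnK.
  rewrite -(bin_fact nk) (nderivn_def n P) hornerMn.
  set v := (X in has_integral _ X -> _) => f_int.
  have -> : ('C(k, n) * (n`! * (k - n)`!))%:R * P^`N(n).[t a] = v.
    by rewrite /v -mulr_natr !natrM; ring.
  apply: (@has_integral_eq_off_point _ _ _ _ (t a) _ f_int) => x xt.
  by rewrite divdiff_truncpow_coincident //; ring.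
elim: m i => [|m IHm] i iN Ai mk; first by apply: coincident; rewrite ?addn0.
have [tt|tt] := eqVneq (t i) (t (i + m.+1)%N).
  by apply: coincident => //; case: mk => [//|[_]]; rewrite -tt ltxx.
have mk' : (m <= k)%N by case: mk => [/ltnW //|[[->]]].
have iN1 : (i.+1 + m <= N)%N by rewrite addSnnS.
have iN0 : (i + m <= N)%N by apply: leq_trans iN; rewrite leq_add2l.
have Ai1 : A <= t i.+1 by apply: le_trans Ai (t_nd _ _ _ _); lia.
have L := IHm i.+1 iN1 Ai1 (or_introl mk').
have := has_integralP (-1) (IHm i iN0 Ai (or_introl mk')) L.
move/(has_integralZ (t (i + m.+1)%N - t i)^-1).
rewrite pdivdiffS (negbTE tt).
by congr has_integral; [apply/funext => x; rewrite divdiffS (negbTE tt)|]; ring.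
Qed.

Lemma derivn_vanish Q A n e : (e <= n)%N ->
  ((Q * ('X - A%:P) ^+ n.+1)^`(e)).[A] = 0.
Proof.
elim: e n Q => [|e IHe] n Q en.
  by rewrite hornerM horner_exp !hornerE subrr exprS mul0r
    mulr0.
case: n en => // n en; rewrite derivSn derivM deriv_exp derivXsubC mul1r.
rewrite (_ : _ + _ =
  (Q^`() * ('X - A%:P) + n.+2%:R *: Q) * ('X - A%:P) ^+ n.+1) ?IHe //=.
by rewrite -mul_polyC polyC_natr -mulr_natr exprS; ring.
Qed.

Lemma derivn_size0 Q n : (size Q <= n)%N -> Q^`(n) = 0.
Proof. by move=> Qn; rewrite nderivn_def nderivn_poly0 // mul0rn. Qed.

(** Only the remainder of [P] modulo (X - t i)^(k+1) prevents [P] from vanishing to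
    order k + 1 at the first knot; it has degree at most [k], so neither the
    derivative of order k + 1 nor the divided difference sees it.  The cut-off at
    the first knot costs nothing, because the B-spline vanishes to its left. *)
Lemma bspline_peano t N k i P : nondecr_upto t N -> (i + k.+1 <= N)%N ->
  t i < t (i + k.+1)%N ->
  has_integral (fun x => bspline k t i x * P^`(k.+1).[x])
    ((k.+1)`!%:R * pdivdiff t i k.+1 P).
Proof.
move=> t_nd iN tt; pose A := t i; pose W := ('X - A%:P) ^+ k.+1.
have Wm : W \is monic by exact/monic_exp/monicXsubC.
have sT : (size (P %% W)%R <= k.+1)%N.
  by rewrite -ltnS -(size_exp_XsubC k.+1 A) ltn_modp monic_neq0.
have PE := Pdiv.IdomainMonic.divp_eq Wm P.
have dP : P^`(k.+1) = ((P %/ W)%R * W)^`(k.+1).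
  by rewrite {1}PE derivnD (derivn_size0 sT) addr0.
have DP : pdivdiff t i k.+1 P = pdivdiff t i k.+1 ((P %/ W)%R * W).
  by rewrite {1}PE linearD /= (pdivdiff_size t_nd iN sT) addr0.
have := @has_integral_divdiff_truncpow t N k ((P %/ W)%R * W) A i k.+1 t_nd iN
  (lexx _) (or_intror (conj erefl tt)) (fun e => @derivn_vanish _ _ _ e).
move=> /(has_integralZ k.+1%:R); rewrite dP DP factS natrM -mulrA.
congr has_integral; apply/funext => x; rewrite !mulrA; congr (_ * _).
have [Ax|xA] := leP A x; first by rewrite mulr1.
rewrite mulr0 mul0r.
by rewrite (bspline_left_eq0 t_nd).
Qed.

Lemma bspline_moment t N k i d x : nondecr_upto t N -> (i + k.+1 <= N)%N ->
  t i < t (i + k.+1)%N ->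
  has_integral (fun s => bspline k t i s * (s - x) ^+ d)
    (pdivdiff t i k.+1 (('X - x%:P) ^+ (k.+1 + d)) / 'C(d + k.+1, d)%:R).
Proof.
move=> t_nd iN tt.
have := bspline_peano (('X - x%:P) ^+ (k.+1 + d)) t_nd iN tt.
have nz : ((k.+1 + d) ^_ k.+1)%:R != 0 :> R.
  by rewrite pnatr_eq0 -lt0n ffact_gt0 leq_addr.
move/(has_integralZ ((k.+1 + d) ^_ k.+1)%:R^-1); congr has_integral.
  apply/funext => s; rewrite derivn_XsubC_exp addKn hornerMn.
  rewrite horner_exp hornerXsubC.
  by rewrite -[_ *+ _]mulr_natr; field.
rewrite -bin_sub ?leq_addr // addKn (addnC d) -bin_ffact natrM.
have ? : (k.+1)`!%:R != 0 :> R by rewrite pnatr_eq0 -lt0n fact_gt0.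
have ? : 'C(k.+1 + d, k.+1)%:R != 0 :> R.
  by rewrite pnatr_eq0 -lt0n bin_gt0 leq_addr.
by field; apply/andP.
Qed.

End Peano.

(** * Moments of splines and the linear system *)

Section SiacMoments.
Variables (R : realType) (r k : nat) (j : 'I_r.+1 -> nat).
Implicit Types (t : nat -> R) (c : 'cV[R]_r.+1) (x h xi : R) (d N : nat).

Definition supported_knots t N : Prop :=
  forall l : 'I_r.+1, (j l + k.+1 <= N)%N /\ t (j l) < t (j l + k.+1)%N.

Definition spline_moment t c x d : R :=
  \sum_(l < r.+1) c l 0 *
    (pdivdiff t (j l) k.+1 (('X - x%:P) ^+ (k.+1 + d)) / 'C(d + k.+1, d)%:R).

Lemma has_integral_spline_moment t N c x d :
  nondecr_upto t N -> supported_knots t N ->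
  has_integral (fun s => spline k j t c s * (s - x) ^+ d)
    (spline_moment t c x d).
Proof.
move=> t_nd t_supp.
have := has_integral_sum (index_enum 'I_r.+1) (fun l => has_integralZ (c l 0)
  (bspline_moment d x t_nd (t_supp l).1 (t_supp l).2)).
congr has_integral; apply/funext => s; rewrite /spline mulr_suml.
by apply: eq_bigr => l _; rewrite mulrA.
Qed.

Lemma convolution_spline_moment t N c x d :
  nondecr_upto t N -> supported_knots t N ->
  convolution (spline k j t c) (fun y => (- y) ^+ d) x = spline_moment t c x d.
Proof.
move=> t_nd t_supp.
rewrite -(has_integral_Rintegral (has_integral_spline_moment c x d t_nd t_supp)).
by congr Rintegral; apply/funext => s; rewrite opprB.
Qed.

(** The binomial theorem under the integral, read off from uniqueness of the
    integral. *)
Lemma spline_moment_recenter t N c x xi d :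
  nondecr_upto t N -> supported_knots t N ->
  spline_moment t c x d =
  \sum_(e < d.+1) ('C(d, e)%:R * (xi - x) ^+ (d - e)) * spline_moment t c xi e.
Proof.
move=> t_nd t_supp.
rewrite -(has_integral_Rintegral (has_integral_spline_moment c x d t_nd t_supp)).
apply: has_integral_Rintegral.
have := has_integral_sum (index_enum 'I_d.+1)
  (fun e => has_integralZ ('C(d, e)%:R * (xi - x) ^+ (d - e))
     (has_integral_spline_moment c xi e t_nd t_supp)).
congr has_integral; apply/funext => s.
have -> : s - x = (xi - x) + (s - xi) by ring.
rewrite exprDn mulr_sumr; apply: eq_bigr => e _.
by rewrite -[(_ * _) *+ _]mulr_natl; ring.
Qed.

(** Reproduction about the single point [xi] already gives reproduction
    everywhere: recentering the moments at [x] and expanding (- x)^d around [- xi]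
    produce the same coefficients. *)
Lemma siac_coefs_moments t N c xi : nondecr_upto t N -> supported_knots t N ->
  siac_coefs k j t c <->
  forall d, (d <= r)%N -> spline_moment t c xi d = (- xi) ^+ d.
Proof.
move=> t_nd t_supp; split=> [cP d dr|cP d dr x].
  by rewrite -(convolution_spline_moment _ _ _ t_nd t_supp) cP.
rewrite (convolution_spline_moment _ _ _ t_nd t_supp).
rewrite (spline_moment_recenter c x xi d t_nd t_supp).
have -> : (- x) ^+ d = ((xi - x) + - xi) ^+ d by congr (_ ^+ d); ring.
rewrite exprDn; apply: eq_bigr => e _.
rewrite cP ?(leq_trans _ dr) -1?ltnS //.
by rewrite -[(_ * _) *+ _]mulr_natl; ring.
Qed.

Lemma reproduction_mxE t (d l : 'I_r.+1) :
  reproduction_mx k j t d l = pdivdiff t (j l) k.+1 'X^(k.+1 + d).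
Proof.
rewrite mxE /pdivdiff; congr divdiff.
by apply/funext => x; rewrite hornerXn.
Qed.

Lemma spline_moment_affine t c h xi (d : 'I_r.+1) : h != 0 ->
  spline_moment (fun i => h * t i + xi) c xi d =
  h ^+ d / 'C(d + k.+1, d)%:R * (reproduction_mx k j t *m c) d 0.
Proof.
move=> h0; rewrite !mxE mulr_sumr; apply: eq_bigr => l _.
rewrite reproduction_mxE.
have -> : pdivdiff (fun i => h * t i + xi) (j l) k.+1
    (('X - xi%:P) ^+ (k.+1 + d)) = h ^+ d * pdivdiff t (j l) k.+1 'X^(k.+1 + d).
  apply: (mulfI (expf_neq0 k.+1 h0)); rewrite pdivdiff_affine //.
  rewrite rmorphXn rmorphB /= comp_polyX comp_polyC addrK exprZn linearZ /=.
  by rewrite exprD mulrA.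
by ring.
Qed.

(** The product of the two diagonal matrices and the vector of powers of [xi]. *)
Definition siac_rhs h xi : 'cV[R]_r.+1 :=
  \col_(d < r.+1) ((-1) ^+ d * 'C(d + k.+1, d)%:R * h ^- d * xi ^+ d).

Lemma siac_formulaE t h xi :
  siac_formula k j t h xi = invmx (reproduction_mx k j t) *m siac_rhs h xi.
Proof.
rewrite /siac_formula -!mulmxA; congr (_ *m _).
by apply/colP => d; rewrite !mul_diag_mx !mxE !mulrA.
Qed.

Lemma siac_coefs_linear_system t N c h xi :
  nondecr_upto t N -> supported_knots t N -> 0 < h ->
  siac_coefs k j (fun i => h * t i + xi) c <->
  reproduction_mx k j t *m c = siac_rhs h xi.
Proof.
move=> t_nd t_supp h_gt0.
have h0 : h != 0 by rewrite gt_eqF.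
rewrite (@siac_coefs_moments _ N _ xi); first last.
- by move=> l; rewrite ltrD2r ltr_pM2l //; exact: t_supp.
- by move=> a b ab bN; rewrite lerD2r ler_pM2l // t_nd.
have C0 d : 'C(d + k.+1, d)%:R != 0 :> R.
  by rewrite pnatr_eq0 -lt0n bin_gt0 leq_addr.
split=> [cP|cP d dr].
  apply/colP => d; have := cP d; rewrite -ltnS ltn_ord => /(_ isT).
  rewrite spline_moment_affine // exprNn => cE; rewrite [RHS]mxE.
  have hd : h ^+ d != 0 by rewrite expf_neq0.
  move: (C0 d) => ?.
  have -> : (reproduction_mx k j t *m c) d 0 = ('C(d + k.+1, d)%:R / h ^+ d) *
    (h ^+ d / 'C(d + k.+1, d)%:R * (reproduction_mx k j t *m c) d 0).
    by field; apply/andP.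
  by rewrite cE; field.
have := spline_moment_affine t c xi (Ordinal (dr : (d < r.+1)%N)) h0.
rewrite cP [siac_rhs _ _ _ _]mxE /= (exprNn xi) => ->.
have hd : h ^+ d != 0 by rewrite expf_neq0.
by move: (C0 d) => ?; field; apply/andP.
Qed.

End SiacMoments.

(** * The coefficients of the kernel *)

Theorem theorem3p1 (R : realType) (r k : nat) (j : 'I_r.+1 -> nat)
    (t : nat -> R) (h : R)
    (j_first : j ord0 = 0%N)
    (j_incr : forall a b : 'I_r.+1, (a < b)%N -> (j a < j b)%N)
    (t_nondecr : forall a b : nat,
       (a <= b)%N -> (b <= j ord_max + k.+1)%N -> t a <= t b)
    (t_supp : forall l : 'I_r.+1, t (j l) < t (j l + k.+1)%N)
    (h_gt0 : 0 < h) :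
  [/\ reproduction_mx k j t \in unitmx,
      forall (xi : R) (c : 'cV[R]_r.+1),
        siac_coefs k j (fun i => h * t i + xi) c
        <-> c = siac_formula k j t h xi
    & forall l : 'I_r.+1, exists p : {poly R},
        size p = r.+1 /\
        forall (xi : R) (c : 'cV[R]_r.+1),
          siac_coefs k j (fun i => h * t i + xi) c -> c l 0 = p.[xi]].
Proof.
set M := reproduction_mx k j t; set N := (j ord_max + k.+1)%N.
have t_nd : nondecr_upto t N := t_nondecr.
have t_sp : supported_knots k j t N.
  move=> l; split=> //; rewrite leq_add2r.
  by have [->//|lm] := eqVneq l ord_max; apply/ltnW/j_incr;
    rewrite ltn_neqAle -ltnS ltn_ord andbT.
(* A choice [f] of columns covers both M and its minors without the last row. *)
have sub_det_gt0 n (f : nat -> 'I_r.+1) :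
    (forall a b, (a < b < n)%N -> (f a < f b)%N) ->
    0 < \det (\matrix_(a < n, b < n) pdivdiff t (j (f b)) k.+1 'X^(k.+1 + a)).
  move=> f_incr; apply: (@det_pdivdiff_gt0 _ t N n k.+1 (j \o f)) => //.
  - by move=> a b /f_incr /j_incr.
  - by move=> a _; exact: t_sp.
have M_unit : M \in unitmx.
  rewrite unitmxE unitfE gt_eqF //.
  have -> : \det M = \det (\matrix_(a < r.+1, b < r.+1)
      pdivdiff t (j (inord b)) k.+1 'X^(k.+1 + a)).
    by congr (\det _); apply/matrixP => a b; rewrite reproduction_mxE mxE inord_val.
  by apply: sub_det_gt0 => a b /andP[ab bn]; rewrite !inordK // (ltn_trans ab bn).
have last_col_neq0 l : invmx M l ord_max != 0.
  (* The last column of the adjugate: minors without row r and column l. *)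
  rewrite /invmx M_unit !mxE mulf_neq0 //.
    by rewrite invr_eq0 -unitfE -unitmxE.
  rewrite /cofactor mulf_neq0 ?signr_eq0 // gt_eqF //.
  have -> : \det (row' ord_max (col' l M)) = \det (\matrix_(a < r, b < r)
      pdivdiff t (j (inord (bump l b))) k.+1 'X^(k.+1 + a)).
    congr (\det _); apply/matrixP => a b; rewrite [RHS]mxE [LHS]mxE [LHS]mxE.
    rewrite reproduction_mxE lift_max; congr (pdivdiff t (j _) _ _).
    by apply/val_inj; rewrite /= inordK //; exact: (ltn_ord (lift l b)).
  apply: (sub_det_gt0 r (fun b => inord (bump l b))) => a b /andP[ab bn].
  by rewrite !inordK /bump; lia.
have solve xi c : siac_coefs k j (fun i => h * t i + xi) c <->
    c = siac_formula k j t h xi.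
  rewrite (siac_coefs_linear_system c xi t_nd t_sp h_gt0) siac_formulaE.
  by split=> [<-|->]; rewrite ?mulKmx ?mulKVmx.
split=> // l.
pose a (d : nat) : R :=
  invmx M l (inord d) * ((-1) ^+ d * 'C(d + k.+1, d)%:R * h ^- d).
exists (\poly_(d < r.+1) a d); split.
  have inord_r : inord r = ord_max :> 'I_r.+1 by apply/val_inj; rewrite /= inordK.
  rewrite size_poly_eq //= /a inord_r !mulf_neq0 ?signr_eq0 //.
    by rewrite pnatr_eq0 -lt0n bin_gt0 leq_addr.
  by rewrite invr_eq0 expf_neq0 // gt_eqF.
move=> xi c /solve ->; rewrite siac_formulaE mxE horner_poly.
by apply: eq_bigr => d _; rewrite mxE /a inord_val !mulrA.
Qed.
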